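(* For each of the pairs $(L,\ell)=(\mathbf{IL}^-(\mathbf{J2},\mathbf{J5}),\ \mathbf{il}^-(\mathbf{I4},\mathbf{J25}^u))$ and $(L,\ell)=(\mathbf{IL}^-(\mathbf{J2},\mathbf{J4}_+,\mathbf{J5}),\ \mathbf{il}^-(\mathbf{I2},\mathbf{J25}^u))$, and every $\mathcal{L}(\Box,\mathbf{I})$-formula $A$: if $L\vdash A$ then $\ell\vdash A$.
   Context: The language $\mathcal{L}(\Box,\rhd)$ consists of propositional variables, $\bot$, $\to$, unary $\Box$ and binary $\rhd$; other connectives as usual, $\Diamond A:\equiv\neg\Box\neg A$, $\mathbf{I}A:\equiv\top\rhd A$; $\mathcal{L}(\Box,\mathbf{I})$-formulas are those built from variables and $\bot$ by $\to$, $\Box$, $\mathbf{I}$. The logic $\mathbf{IL}^-$ has as axioms all tautologies, $\Box(A\to B)\to(\Box A\to\Box B)$, $\Box(\Box A\to A)\to\Box A$, $\mathbf{J3}$: $(A\rhd C)\land(B\rhd C)\to(A\lor B)\rhd C$, $\mathbf{J6}$: $\Box A\leftrightarrow(\neg A\rhd\bot)$; rules: Modus Ponens, Necessitation, from $A\to B$ infer $(C\rhd A)\to(C\rhd B)$, and from $A\to B$ infer $(B\rhd C)\to(A\rhd C)$. Schemata: $\mathbf{J2}$: $(A\rhd B)\land(B\rhd C)\to A\rhd C$; $\mathbf{J4}_+$: $\Box(A\to B)\to(C\rhd A\to C\rhd B)$; $\mathbf{J5}$: $\Diamond A\rhd A$. $L(\Sigma_1,\dots,\Sigma_k)$ is $L$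 with schemata $\Sigma_i$ added as axioms. The logic $\mathbf{il}^-$ has as axioms all tautologies of $\mathcal{L}(\Box,\mathbf{I})$, $\Box(A\to B)\to(\Box A\to\Box B)$, $\Box(\Box A\to A)\to\Box A$, $\Box\bot\leftrightarrow\mathbf{I}\bot$; rules Modus Ponens, Necessitation, and from $A\to B$ infer $\mathbf{I}A\to\mathbf{I}B$. Schemata: $\mathbf{I2}$: $\Box(A\to B)\to(\mathbf{I}A\to\mathbf{I}B)$; $\mathbf{I4}$: $\mathbf{I}A\land\Diamond\top\to\Diamond A$; $\mathbf{J25}^u$: $\Box(A\to\Diamond B)\to(\mathbf{I}A\to\mathbf{I}B)$. *)

(* Defs.v *)
From Stdlib Require Import List Bool.
Import ListNotations.

Reserved Notation "A ~> B" (at level 90, right associativity).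
Reserved Notation "A <~> B" (at level 95, no associativity).
Reserved Notation "A ▷ B" (at level 70, no associativity).
Reserved Notation "□ A" (at level 30, right associativity).
Reserved Notation "◇ A" (at level 30, right associativity).

Inductive form : Type :=
| Var (n : nat)
| Bot
| Imp (A B : form)
| Box (A : form)
| Rhd (A B : form).

Definition Neg (A : form) : form := Imp A Bot.
Definition Top : form := Neg Bot.
Definition Or (A B : form) : form := Imp (Neg A) B.
Definition And (A B : form) : form := Neg (Imp A (Neg B)).
Definition Iff (A B : form) : form := And (Imp A B) (Imp B A).
Definition Dia (A : form) : form := Neg (Box (Neg A)).
Definition II (A : form) : form := Rhd Top A.

Declare Scope form_scope.
Delimit Scope form_scope with form.
Bind Scope form_scope with form.
Notation "A ~> B" := (Imp A B) : form_scope.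
Notation "~ A" := (Neg A) : form_scope.
Notation "A \/ B" := (Or A B) : form_scope.
Notation "A /\ B" := (And A B) : form_scope.
Notation "A <~> B" := (Iff A B) : form_scope.
Notation "□ A" := (Box A) : form_scope.
Notation "◇ A" := (Dia A) : form_scope.
Notation "A ▷ B" := (Rhd A B) : form_scope.

(** A tautology is a formula true under every Boolean valuation of the
    variables and of the formulas □A and A ▷ B, the latter taken as
    additional atoms. *)
Fixpoint eval (v : form -> bool) (F : form) : bool :=
  match F with
  | Bot => false
  | Imp A B => implb (eval v A) (eval v B)
  | Var _ | Box _ | Rhd _ _ => v F
  end.

Definition tautology (F : form) : Prop := forall v, eval v F = true.

Definition J2 (F : form) : Prop :=
  exists A B C, F = (((A ▷ B) /\ (B ▷ C)) ~> (A ▷ C))%form.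
Definition J4plus (F : form) : Prop :=
  exists A B C, F = (□ (A ~> B) ~> ((C ▷ A) ~> (C ▷ B)))%form.
Definition J5 (F : form) : Prop :=
  exists A, F = ((◇ A) ▷ A)%form.

Inductive IL_minus (S : list (form -> Prop)) : form -> Prop :=
| IL_taut A : tautology A -> IL_minus S A
| IL_K A B : IL_minus S (□ (A ~> B) ~> (□ A ~> □ B))
| IL_Lob A : IL_minus S (□ (□ A ~> A) ~> □ A)
| IL_J3 A B C : IL_minus S (((A ▷ C) /\ (B ▷ C)) ~> ((A \/ B) ▷ C))
| IL_J6 A : IL_minus S (□ A <~> ((~ A) ▷ Bot))
| IL_schema (Sigma : form -> Prop) A : In Sigma S -> Sigma A -> IL_minus S A
| IL_MP A B : IL_minus S (A ~> B) -> IL_minus S A -> IL_minus S B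
| IL_Nec A : IL_minus S A -> IL_minus S (□ A)
| IL_R1 A B C : IL_minus S (A ~> B) -> IL_minus S ((C ▷ A) ~> (C ▷ B))
| IL_R2 A B C : IL_minus S (A ~> B) -> IL_minus S ((B ▷ C) ~> (A ▷ C)).

Inductive uform : Type :=
| uVar (n : nat)
| uBot
| uImp (A B : uform)
| uBox (A : uform)
| uI (A : uform).

Definition uNeg (A : uform) : uform := uImp A uBot.
Definition uTop : uform := uNeg uBot.
Definition uAnd (A B : uform) : uform := uNeg (uImp A (uNeg B)).
Definition uIff (A B : uform) : uform := uAnd (uImp A B) (uImp B A).
Definition uDia (A : uform) : uform := uNeg (uBox (uNeg A)).

Declare Scope uform_scope.
Delimit Scope uform_scope with uform.
Bind Scope uform_scope with uform.
Notation "A ~> B" := (uImp A B) : uform_scope.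
Notation "~ A" := (uNeg A) : uform_scope.
Notation "A /\ B" := (uAnd A B) : uform_scope.
Notation "A <~> B" := (uIff A B) : uform_scope.
Notation "□ A" := (uBox A) : uform_scope.
Notation "◇ A" := (uDia A) : uform_scope.

(** L(□,I) is a fragment of L(□,▷), with [I A] standing for [Top ▷ A];
    [embed] is the inclusion. *)
Fixpoint embed (A : uform) : form :=
  match A with
  | uVar n => Var n
  | uBot => Bot
  | uImp A B => Imp (embed A) (embed B)
  | uBox A => Box (embed A)
  | uI A => II (embed A)
  end.

Fixpoint ueval (v : uform -> bool) (F : uform) : bool :=
  match F with
  | uBot => false
  | uImp A B => implb (ueval v A) (ueval v B)
  | uVar _ | uBox _ | uI _ => v F
  end.

Definition utautology (F : uform) : Prop := forall v, ueval v F = true.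

Definition I2 (F : uform) : Prop :=
  exists A B, F = (□ (A ~> B) ~> (uI A ~> uI B))%uform.
Definition I4 (F : uform) : Prop :=
  exists A, F = ((uI A /\ ◇ uTop) ~> ◇ A)%uform.
Definition J25u (F : uform) : Prop :=
  exists A B, F = (□ (A ~> ◇ B) ~> (uI A ~> uI B))%uform.

Inductive il_minus (S : list (uform -> Prop)) : uform -> Prop :=
| il_taut A : utautology A -> il_minus S A
| il_K A B : il_minus S (□ (A ~> B) ~> (□ A ~> □ B))
| il_Lob A : il_minus S (□ (□ A ~> A) ~> □ A)
| il_IBot : il_minus S (□ uBot <~> uI uBot)
| il_schema (Sigma : uform -> Prop) A : In Sigma S -> Sigma A -> il_minus S A
| il_MP A B : il_minus S (A ~> B) -> il_minus S A -> il_minus S B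
| il_Nec A : il_minus S A -> il_minus S (□ A)
| il_RI A B : il_minus S (A ~> B) -> il_minus S (uI A ~> uI B).

(* Main.v *)
(** The binary modality of L(□,▷) can be interpreted in L(□,I): read [A ▷ B]
    as [□ (A ~> ◇ B) \/ I B]. Under this reading J3, J5, J6 and the rules of
    IL⁻ hold in il⁻(J25u), J2 is transitivity of ◇ together with J25u, and
    J4+ reduces to I2. On the fragment the reading changes nothing up to
    provable equivalence, because [□ ◇ B] yields [□ ⊥] by Löb, hence [I ⊥] and
    [I B]. *)
Require Import Defs.
From Stdlib Require Import List.
Import ListNotations.

Fixpoint interp (F : form) : uform :=
  match F with
  | Var n => uVar n
  | Bot => uBot
  | Imp A B => uImp (interp A) (interp B)
  | Box A => uBox (interp A)
  | Rhd A B =>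
      (~ □ (interp A ~> ◇ interp B) ~> uI (interp B))%uform
  end.

(* Closes [il_minus S G] when [G] is a tautological consequence of the
   theorems of [il_minus S] in the context. *)
Ltac prop :=
  repeat match goal with
    | H : il_minus ?S ?A |- il_minus ?S ?G => refine (il_MP S A G _ H); clear H
    end;
  apply il_taut; let v := fresh "v" in intro v;
  unfold uIff, uAnd, uDia, uTop, uNeg; cbn [ueval];
  repeat match goal with
    | |- context [ueval v ?A] => destruct (ueval v A)
    | |- context [v ?A] => destruct (v A)
    end; reflexivity.

Lemma box_mono S A B :
  il_minus S (A ~> B) -> il_minus S (□ A ~> □ B).
Proof.
intros H. exact (il_MP _ _ _ (il_K S A B) (il_Nec _ _ H)).
Qed.

Lemma box_mono2 S A B C :
  il_minus S (A ~> B ~> C) -> il_minus S (□ A ~> □ B ~> □ C).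
Proof.
intros H%box_mono. pose proof (il_K S B C). prop.
Qed.

(** The 4 axiom from Löb's, by the usual choice of [A /\ □ A] as the Löb formula. *)
Lemma box_trans S A : il_minus S (□ A ~> □ □ A).
Proof.
assert (H1 : il_minus S (□ (A /\ □ A) ~> □ A)) by (apply box_mono; prop).
assert (H2 : il_minus S (□ (A /\ □ A) ~> □ □ A)) by (apply box_mono; prop).
assert (H3 : il_minus S (□ A ~> □ (□ (A /\ □ A) ~> (A /\ □ A))))
  by (apply box_mono; prop).
pose proof (il_Lob S (A /\ □ A)). prop.
Qed.

(** By 4, [□ (A ~> B)] is available under the box, where it turns [◇ A] into [◇ B]. *)
Lemma box_imp_dia S A B C :
  il_minus S (□ (A ~> B) ~> □ (C ~> ◇ A) ~> □ (C ~> ◇ B)).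
Proof.
assert (H : il_minus S (□ (A ~> B) ~> □ (~ B) ~> □ (~ A)))
  by (apply box_mono2; prop).
assert (H2 : il_minus S (□ □ (A ~> B) ~> □ (C ~> ◇ A) ~> □ (C ~> ◇ B)))
  by (apply box_mono2; prop).
pose proof (box_trans S (A ~> B)). prop.
Qed.

Lemma box_dia_trans S A B C :
  il_minus S (□ (A ~> ◇ B) ~> □ (B ~> ◇ C) ~> □ (A ~> ◇ C)).
Proof.
(* Contrapositive of passing from [◇ B] to [◇ C]; 4 supplies [□ □ (~ C)] from [□ (~ C)]. *)
assert (H : il_minus S (□ □ (~ C) ~> □ (B ~> ◇ C) ~> □ (~ B)))
  by (apply box_mono2; prop).
pose proof (box_trans S (~ C)%uform).
assert (H2 : il_minus S (□ (A ~> ◇ B) ~> □ □ (B ~> ◇ C) ~> □ (A ~> ◇ C)))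
  by (apply box_mono2; prop).
pose proof (box_trans S (B ~> ◇ C)%uform). prop.
Qed.

Lemma box_top_dia S B : il_minus S (□ (uTop ~> ◇ B) ~> □ uBot).
Proof.
(* Since [□ uBot] refutes [◇ B], the premise boxes the Löb hypothesis for [uBot]. *)
assert (H : il_minus S (□ uBot ~> □ (~ B))) by (apply box_mono; prop).
assert (H2 : il_minus S (□ (uTop ~> ◇ B) ~> □ (□ uBot ~> uBot)))
  by (apply box_mono; prop).
pose proof (il_Lob S uBot). prop.
Qed.

(** [interp] sends the atom [A ▷ B] to a compound formula, so the pulled-back valuation evaluates
    translations instead of looking them up in [v]. *)
Lemma ueval_interp v F :
  ueval v (interp F) = eval (fun G => ueval v (interp G)) F.
Proof.
induction F as [| |A IHA B IHB| |]; try reflexivity.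
cbn. now rewrite IHA, IHB.
Qed.

Lemma interp_tautology F : tautology F -> utautology (interp F).
Proof.
intros H v. rewrite ueval_interp. apply H.
Qed.

Lemma interp_sound S S' F :
  (forall Sigma A, In Sigma S -> Sigma A -> il_minus S' (interp A)) ->
  IL_minus S F -> il_minus S' (interp F).
Proof.
intros HS H.
induction H as [A HA|A B|A|A B C|A|Sigma A HSigma HA|A B _ IHAB _ IHA|A _ IHA
               |A B C _ IHAB|A B C _ IHAB]; cbn in *.
- now apply il_taut, interp_tautology.
- apply il_K.
- apply il_Lob.
- set (a := interp A) in *; set (b := interp B) in *; set (c := interp C) in *.
  assert (H : il_minus S' (□ (a ~> ◇ c) ~> □ (b ~> ◇ c) ~>
                           □ ((~ a ~> b) ~> ◇ c)))
    by (apply box_mono2; prop).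
  prop.
- set (a := interp A) in *.
  (* J6: [◇ uBot] is refutable, so the box disjunct amounts to [□ a]; the other disjunct, [uI uBot],
     gives [□ uBot] and hence [□ a]. *)
  assert (Htop : il_minus S' (□ (~ uBot))) by (apply il_Nec; prop).
  assert (H1 : il_minus S' (□ a ~> □ (~ a ~> ◇ uBot))) by (apply box_mono; prop).
  assert (H2 : il_minus S' (□ (~ a ~> ◇ uBot) ~> □ a)) by (apply box_mono; prop).
  assert (H3 : il_minus S' (□ uBot ~> □ a)) by (apply box_mono; clear; prop).
  pose proof (il_IBot S'). prop.
- now apply (HS Sigma).
- exact (il_MP _ _ _ IHAB IHA).
- now apply il_Nec.
- pose proof (il_RI _ _ _ IHAB).
  pose proof (box_imp_dia S' (interp A) (interp B) (interp C)).
  apply il_Nec in IHAB. prop.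
- assert (H : il_minus S' (□ (interp B ~> ◇ interp C) ~>
                           □ (interp A ~> ◇ interp C)))
    by (apply box_mono; prop).
  prop.
Qed.

Lemma interp_embed S A : il_minus S (interp (embed A) <~> A).
Proof.
induction A as [n| |A IHA B IHB|A IHA|A IHA]; cbn.
- prop.
- prop.
- prop.
- assert (H1 : il_minus S (□ interp (embed A) ~> □ A)) by (apply box_mono; prop).
  assert (H2 : il_minus S (□ A ~> □ interp (embed A))) by (apply box_mono; prop).
  prop.
- set (a := interp (embed A)) in *.
  assert (H1 : il_minus S (uI a ~> uI A)) by (apply il_RI; prop).
  assert (H2 : il_minus S (uI A ~> uI a)) by (apply il_RI; prop).
  assert (H3 : il_minus S (uI uBot ~> uI A)) by (apply il_RI; clear; prop).
  pose proof (box_top_dia S a). pose proof (il_IBot S). prop.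
Qed.

Lemma interp_J2 S F : In J25u S -> J2 F -> il_minus S (interp F).
Proof.
intros HS (A & B & C & ->). cbn.
set (a := interp A); set (b := interp B); set (c := interp C).
assert (H : il_minus S (□ (b ~> ◇ c) ~> (uI b ~> uI c)))
  by (apply (il_schema S J25u); [exact HS | now exists b, c]).
(* If [b ▷ c] holds by its box disjunct, either disjunct of [a ▷ b] carries over, by transitivity or
   by [H]; otherwise [uI c] is already the conclusion. *)
pose proof (box_dia_trans S a b c). prop.
Qed.

Lemma interp_J4plus S F : In I2 S -> J4plus F -> il_minus S (interp F).
Proof.
intros HS (A & B & C & ->). cbn.
set (a := interp A); set (b := interp B); set (c := interp C).
assert (H : il_minus S (□ (a ~> b) ~> (uI a ~> uI b)))
  by (apply (il_schema S I2); [exact HS | now exists a, b]).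
pose proof (box_imp_dia S a b c). prop.
Qed.

Lemma interp_J5 S F : J5 F -> il_minus S (interp F).
Proof.
intros (A & ->). cbn.
assert (H : il_minus S (□ (◇ interp A ~> ◇ interp A)))
  by (apply il_Nec; prop).
prop.
Qed.

(** Soundness proves the translation of [embed A], which [interp_embed] turns back into [A]; only
    the added schemata remain to be checked. *)
Lemma embed_conservative S S' A :
  (forall Sigma F, In Sigma S -> Sigma F -> il_minus S' (interp F)) ->
  IL_minus S (embed A) -> il_minus S' A.
Proof.
intros HS H%(interp_sound _ S' _ HS).
pose proof (interp_embed S' A). prop.
Qed.

Theorem theorem4p15 :
  (forall A : uform,
     IL_minus [J2; J5] (embed A) -> il_minus [I4; J25u] A) /\
  (forall A : uform,
     IL_minus [J2; J4plus; J5] (embed A) -> il_minus [I2; J25u] A).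
Proof.
split; intros A; apply embed_conservative; intros Sigma F HSigma.
- destruct HSigma as [<-|[<-|[]]].
  + apply interp_J2. cbn. tauto.
  + apply interp_J5.
- destruct HSigma as [<-|[<-|[<-|[]]]].
  + apply interp_J2. cbn. tauto.
  + apply interp_J4plus. cbn. tauto.
  + apply interp_J5.
Qed.
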